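(* If $Q\in\mu^A$, that is, if $Q$ is a quiver that is mutation equivalent to an orientation of a type A Dynkin diagram, then $Q$ is a $\mathcal{Q}^N$ quiver (for some $N\ge1$).
   Context: Quivers are finite connected directed graphs without loops or 2-cycles. The mutation $\mu_k$ of a quiver at a vertex $k$ does: (1) for every two-arrow path $i\to k\to j$ add a new arrow $i\to j$; (2) reverse all arrows incident to $k$; (3) repeatedly remove oriented 2-cycles until none remain. Two quivers are mutation equivalent if a finite sequence of mutations sends one to the other. $\mu^A$ denotes the set of quivers mutation equivalent to orientations of type A Dynkin diagrams. $\mathcal{Q}^N$ quivers. For $N\ge1$, a quiver $Q^N$ is a finite connected quiver with vertex set $\{v^i_\ell\mid 1\le i\le N,\ 1\le \ell\le k_i\}$ (with $k_i\ge1$) whose arrows are exactly: (1) the vertical arrows $v^i_1\leftarrow v^i_2\leftarrow\cdots\leftarrow v^i_{k_i}$ for $i=1,\dots,N$ (the $i$-th vertical chain); (2) oblique arrows: for two distinct chains, the arrows between them (if there are any) form exactly one path $v^i_{a_1}\to v^j_{b_1}\to v^i_{a_2}\to v^j_{b_2}\to v^i_{a_3}\to\cdots$ (starting in one of the two chains, called chain $i$, and ending in either), with $1\le a_1<a_2<\cdots\le k_i$ and $1\le b_1<b_2<\cdots\le k_j$; (3) if $3\le m\le N$, $i_1,\dots,i_m$ are pairwise distinct and there is an arrow (in either direction) between the chains $i_r$ and $i_{r+1}$ for each $r=1,\dots,m-1$, then there is no arrow between the chains $i_1$ and $i_m$. A quiver is called a $\mathcal{Q}^N$ quiver if its vertices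 can be labelled so that it has this form for some $N\ge 1$. *)

(* Defs.v *)
From mathcomp Require Import all_boot.

Set Implicit Arguments.
Unset Strict Implicit.
Unset Printing Implicit Defensive.

(* A finite directed multigraph on [V] is given by its arrow multiplicities:
   [a x y] is the number of arrows from [x] to [y]. *)
Definition adjacent (V : finType) (a : V -> V -> nat) : rel V :=
  fun x y => (0 < a x y) || (0 < a y x).

Record quiver (V : finType) := Quiver {
  arrows :> V -> V -> nat;
  quiver_no_loop : forall x, arrows x x = 0;
  quiver_no_2cycle : forall x y, arrows x y = 0 \/ arrows y x = 0;
  quiver_connected : forall x y, connect (adjacent arrows) x y
}.

Section Mutation.
Variable V : finType.
Implicit Types (a : V -> V -> nat) (i j k : V).

Definition add_composites k a i j := a i j + a i k * a k j.

Definition reverse_at k a i j :=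
  if (i == k) || (j == k) then a j i else a i j.

(* Removing 2-cycles between [i] and [j] until none remain deletes
   [minn (a i j) (a j i)] arrows in each direction; this is exactly what
   truncated subtraction computes. *)
Definition cancel_2cycles a i j := a i j - a j i.

Definition mutate_arrows k a :=
  cancel_2cycles (reverse_at k (add_composites k a)).

Variable (Q : quiver V) (k : V).

Lemma mutate_no_loop x : mutate_arrows k Q x x = 0.
Proof. exact: subnn. Qed.

Lemma mutate_no_2cycle x y :
  mutate_arrows k Q x y = 0 \/ mutate_arrows k Q y x = 0.
Proof.
rewrite /mutate_arrows /cancel_2cycles.
set b := reverse_at _ _.
by case/orP: (leq_total (b x y) (b y x)) => /eqP; [left | right].
Qed.

Lemma mutate_adjacent_at x :
  adjacent (mutate_arrows k Q) x k = adjacent Q x k.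
Proof.
rewrite /adjacent /mutate_arrows /cancel_2cycles /reverse_at /add_composites.
rewrite !eqxx orbT /= !quiver_no_loop muln0 mul0n !addn0.
by case: (quiver_no_2cycle Q x k) => ->; rewrite sub0n subn0 // orbC.
Qed.

Lemma adjacent_sym a : symmetric (adjacent a).
Proof. by move=> x y; rewrite /adjacent orbC. Qed.

Lemma mutate_arrow_connect x y :
  0 < Q x y -> connect (adjacent (mutate_arrows k Q)) x y.
Proof.
move=> Qxy; have adjQ : adjacent Q x y by rewrite /adjacent Qxy.
have [xk | x'k] := eqVneq x k.
  by apply: connect1; rewrite adjacent_sym xk mutate_adjacent_at adjacent_sym -xk.
have [yk | y'k] := eqVneq y k.
  by apply: connect1; rewrite yk mutate_adjacent_at -yk.
have Qyx : Q y x = 0 by case: (quiver_no_2cycle Q x y) Qxy => ->.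
have [|] := boolP (0 < Q y k * Q k x).
  rewrite muln_gt0 => /andP[Qyk Qkx].
  apply: (@connect_trans _ _ k); apply: connect1.
    by rewrite mutate_adjacent_at /adjacent Qkx orbT.
  by rewrite adjacent_sym mutate_adjacent_at /adjacent Qyk.
rewrite -eqn0Ngt => /eqP Q0; apply: connect1; apply/orP; left.
rewrite /mutate_arrows /cancel_2cycles /reverse_at /add_composites.
rewrite (negPf x'k) (negPf y'k) /= Qyx Q0 subn0.
exact: ltn_addr.
Qed.

Lemma mutate_connected x y : connect (adjacent (mutate_arrows k Q)) x y.
Proof.
apply: (connect_sub _ (quiver_connected Q x y)) => u w /orP[].
  exact: mutate_arrow_connect.
move/mutate_arrow_connect; rewrite sym_connect_sym //.
exact: adjacent_sym.
Qed.

Definition mutation : quiver V :=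
  Quiver mutate_no_loop mutate_no_2cycle mutate_connected.

End Mutation.

Definition mutation_equivalent (V : finType) (Q Q' : quiver V) : Prop :=
  exists ks : seq V, foldl (@mutation V) Q ks =2 Q'.

(* The vertices of the Dynkin diagram A_n are labelled by an arbitrary
   bijection [f] from [0, n), so this predicate is invariant under quiver
   isomorphism; hence mutation equivalence on a fixed vertex set loses nothing
   in [mu_A]. *)
Definition type_A_orientation (V : finType) (Q : quiver V) : Prop :=
  exists n : nat, 0 < n /\
  exists2 f : 'I_n -> V, bijective f &
    forall i j : 'I_n,
      Q (f i) (f j) + Q (f j) (f i) = (i.+1 == j) || (j.+1 == i) :> nat.

Definition mu_A (V : finType) (Q : quiver V) : Prop :=
  exists2 Q0 : quiver V, type_A_orientation Q0 & mutation_equivalent Q Q0.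

Section QN.
Variables (V : finType) (Q : quiver V) (N : nat) (len : 'I_N -> nat).

(* [v i l] is the vertex of the i-th chain at height [l]; both chains and
   heights are numbered from 0. *)
Variable v : forall i : 'I_N, 'I_(len i) -> V.

Definition vertical_arrows : Prop :=
  forall (i : 'I_N) (l m : 'I_(len i)), Q (v l) (v m) = (l == m.+1 :> nat).

Definition chains_linked : rel 'I_N := fun i j =>
  [exists l : 'I_(len i), exists m : 'I_(len j), adjacent Q (v l) (v m)].

(* For aa = [:: a1; a2; ...] and bb = [:: b1; b2; ...] the arrows of the path
   v^i_a1 -> v^j_b1 -> v^i_a2 -> v^j_b2 -> ... from chain i to chain j are the
   pairs in [zip aa bb], and those from j to i the pairs in
   [zip bb (behead aa)]. The path ends in chain j if aa and bb have equal size,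
   and in chain i if aa has one more element. *)
Definition oblique_path (i j : 'I_N) : Prop :=
  exists (aa : seq 'I_(len i)) (bb : seq 'I_(len j)),
    [/\ 0 < size bb,
        size aa = size bb \/ size aa = (size bb).+1,
        sorted (fun x y : 'I_(len i) => x < y) aa,
        sorted (fun x y : 'I_(len j) => x < y) bb
      & forall (l : 'I_(len i)) (m : 'I_(len j)),
          Q (v l) (v m) = ((l, m) \in zip aa bb) /\
          Q (v m) (v l) = ((m, l) \in zip bb (behead aa))].

Definition oblique_arrows : Prop :=
  forall i j : 'I_N, i != j -> chains_linked i j ->
    oblique_path i j \/ oblique_path j i.

Definition chains_acyclic : Prop :=
  forall (i : 'I_N) (p : seq 'I_N),
    3 <= size (i :: p) <= N -> uniq (i :: p) -> path chains_linked i p ->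
    ~~ chains_linked i (last i p).

End QN.

Definition is_QN_quiver (N : nat) (V : finType) (Q : quiver V) : Prop :=
  exists (len : 'I_N -> nat) (v : forall i : 'I_N, 'I_(len i) -> V),
    [/\ forall i, 0 < len i,
        bijective (fun x : {i : 'I_N & 'I_(len i)} => v (tag x) (tagged x)),
        vertical_arrows Q v,
        oblique_arrows Q v
      & chains_acyclic Q v].

(* Main.v *)
Require Import Defs.
From mathcomp Require Import all_boot.
From mathcomp Require Import zify.

(** Quivers of mutation type A are the quivers of triangulations of a polygon,
    and a triangulation with a distinguished boundary edge is a binary tree:
    the nodes are the diagonals, the root is the distinguished edge, and the
    children of a node are the diagonals among the two other sides of the
    triangle hanging below it.  In such a tree the quiver has, for every node
    [p] with left child [l] and right child [r], the arrows [p -> l], [r -> p]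
    and [l -> r] (those whose endpoints exist and are not the root).  Mutation
    is the flip of a diagonal, that is, a tree rotation.

    The proof therefore has three parts.  An orientation of a path is the quiver
    of a tree without branching ([type_A_tree_quiver]).  Being the quiver of a tree
    is preserved by mutation ([rotate_is_tree] and [mutate_rotation]); as
    mutation at a fixed vertex is an involution ([mutateK]), it is carried back
    along a mutation sequence that ends in a type A orientation.

    Finally a tree gives the chains ([tree_quiver_QN]): take the sets of
    siblings.  Such a chain has one vertex, or a right sibling at the bottom and
    a left sibling above it.  The arrows that remain join a node to its
    children; since a chain has a single parent, two linked chains are a chain
    of siblings and the chain that contains their parent, and the arrows between
    them form [r -> p -> l] or a part of it.  The graph of linked chains is thus
    a forest, and the deepest chain of a hypothetical cycle would have its
    parent in two distinct chains. *)

(** * Quivers of binary trees *)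

Set Implicit Arguments.
Unset Strict Implicit.
Unset Printing Implicit Defensive.

Section TreeQuivers.
Variable V : finType.
Implicit Types (a : V -> V -> nat) (x y k : V) (o : option V).

(** Where a node hangs: its parent, with [None] for the root, and whether it is
    the left child. *)
Definition slot : Type := option V * bool.

Implicit Type pos : V -> slot.

(** The three sides of the triangle below a node, oriented cyclically.  The root
    [None] is a boundary edge, not a vertex, so its triangle contributes at most
    one arrow. *)
Definition tree_arrow pos x y : bool :=
  [|| ((pos y).1 == Some x) && (pos y).2, ((pos x).1 == Some y) && ~~ (pos x).2
    | [&& (pos x).1 == (pos y).1, (pos x).2 & ~~ (pos y).2]].

(** Injectivity makes the tree binary; the strictly increasing [dep], which need
    not be the actual depth, makes it well founded. *)
Definition is_tree pos (dep : option V -> nat) : Prop :=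
  injective pos /\ forall x, dep (pos x).1 < dep (Some x).

Definition tree_quiver a : Prop :=
  exists pos dep, is_tree pos dep /\ forall x y, a x y = tree_arrow pos x y.

Lemma tree_arrowxx pos dep x : is_tree pos dep -> tree_arrow pos x x = false.
Proof.
move=> [_ /(_ x)]; rewrite /tree_arrow andbN andbF orbF.
by case: eqP => [-> | //]; rewrite ltnn.
Qed.

(** * Mutation is tree rotation *)

Section Rotation.
Variables (pos : V -> slot) (dep : option V -> nat) (k : V).
Hypothesis tree_pos : is_tree pos dep.

Let p := (pos k).1.
Let s := (pos k).2.

(** For a left child [k] the rotation turns the subtree [p (k A B) C] into
    [p A (k B C)], and for a right child it is the inverse move.  In terms of
    slots it is the 4-cycle
    [(p, s) -> (p, ~~ s) -> (k, ~~ s) -> (k, s) -> (p, s)], so whatever hangs in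
    these slots is moved and the rest of the tree stays. *)
Definition rotate_slot (c : slot) : slot :=
  if c.1 == p then if c.2 == s then (p, ~~ s) else (Some k, ~~ s)
  else if c.1 == Some k then if c.2 == s then (p, s) else (Some k, s)
  else (c.1, c.2).

(** After the rotation [k] lies above the former sibling subtree and still above
    one of its own: doubling makes room to put it just below [p]. *)
Definition rotate_depth o : nat :=
  if o == Some k then (dep p).*2.+1 else (dep o).*2.

Lemma parent_neq : (Some k == p) = false.
Proof. by apply/eqP => e; have := tree_pos.2 k; rewrite -/p -e ltnn. Qed.

Lemma rotate_slot_inj : injective rotate_slot.
Proof.
have nkp := parent_neq; have npk : (p == Some k) = false by rewrite eq_sym.
case=> [q u] [q' u']; rewrite /rotate_slot /=.
by case: (eqVneq q p) => [->|/negPf qp]; case: (eqVneq q' p) => [->|/negPf qp'];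
  try case: (eqVneq q (Some k)) => [->|/negPf qk];
  try case: (eqVneq q' (Some k)) => [->|/negPf qk'];
  case: (s) u u' => [] [] [] //= /eqP; rewrite ?xpair_eqE ?nkp ?npk ?qp ?qk //=;
  rewrite eq_sym ?qp' ?qk'.
Qed.

Lemma rotate_is_tree : is_tree (rotate_slot \o pos) rotate_depth.
Proof.
have [pos_inj posD] := tree_pos; split; first exact: inj_comp rotate_slot_inj pos_inj.
move=> x; have := posD k; have := posD x; rewrite -/p /= /rotate_slot /rotate_depth.
have npk : (p == Some k) = false by rewrite eq_sym parent_neq.
have [->|nxk] := eqVneq x k; first by rewrite -/p -/s !eqxx /= npk => _ _.
have -> : (Some x == Some k) = false by apply/eqP => -[/eqP]; apply/negP.
case: (eqVneq (pos x).1 p) => [e|np].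
  have -> : ((pos x).2 == s) = false.
    apply/eqP => e2; case/eqP: nxk; apply: pos_inj.
    by rewrite [LHS]surjective_pairing e e2 -surjective_pairing.
  by rewrite /= eqxx e => + _; lia.
case: (eqVneq (pos x).1 (Some k)) => [e|nk].
  by case: ((pos x).2 == s) => /=; rewrite ?npk ?eqxx e; lia.
by rewrite /= (negPf nk); lia.
Qed.

(** The position of a vertex other than [k] relative to the rotation.  The
    negative facts let every slot comparison in the proof of [mutate_rotation]
    be decided by rewriting. *)
Variant rotation_kind x : slot -> Type :=
| KindParent q u of (p == Some x) = true & (q == p) = false & (q == Some k) = false
    : rotation_kind x (q, u)
| KindSibling of (p == Some x) = false : rotation_kind x (p, ~~ s)
| KindChild u of (p == Some x) = false : rotation_kind x (Some k, u)
| KindFar q u of (p == Some x) = false & (q == p) = false & (q == Some k) = false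
    : rotation_kind x (q, u).

Lemma rotation_kindP x : x != k -> rotation_kind x (pos x).
Proof.
move=> nxk; have [pos_inj posD] := tree_pos.
rewrite [pos x]surjective_pairing; have [e|/negPf nxp] := eqVneq p (Some x).
  apply: KindParent; first (by rewrite -e eqxx); apply/eqP => e'; have := posD x; have := posD k.
    by rewrite -/p e e' e ltnn.
  by rewrite -/p e e'; lia.
have [e|/negPf np] := eqVneq (pos x).1 p.
  have -> : (pos x).2 = ~~ s; last by rewrite e; apply: KindSibling.
  have [e2|] := eqVneq (pos x).2 s; last by case: (pos x).2 (s) => [] [].
  by case/eqP: nxk; apply: pos_inj; apply: injective_projections.
have [e|/negPf nk] := eqVneq (pos x).1 (Some k); first by rewrite e; apply: KindChild.
exact: KindFar.
Qed.

(** No composite arrow starts or ends at [k], so mutation just reverses the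
    arrows there; the rotation does the same. *)
Lemma rotation_reverses z : z != k ->
  tree_arrow pos k z = tree_arrow (rotate_slot \o pos) z k /\
  tree_arrow pos z k = tree_arrow (rotate_slot \o pos) k z.
Proof.
have nkp := parent_neq; have npk : (p == Some k) = false by rewrite eq_sym.
have simps := (npk, nkp, eqxx).
move=> nzk; rewrite /tree_arrow /= /rotate_slot /= -/p -/s.
by case: (rotation_kindP nzk) => [q u px np nk|px|u px|q u px np nk]; split;
  rewrite /= ?[p == q]eq_sym ?px ?np ?nk ?simps //; case: (s) => //;
  try case: u => //=; rewrite /= ?[p == q]eq_sym ?px ?np ?nk ?simps ?andbF.
Qed.

Lemma parent_not_below z w : p == Some z ->
  ((pos w).1 == p) || ((pos w).1 == Some k) -> ((pos z).1 == Some w) = false.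
Proof.
move=> /eqP pz wp; apply/eqP => e.
have := tree_pos.2 z; have := tree_pos.2 w; have := tree_pos.2 k.
rewrite -/p pz e; case/orP: wp => /eqP->; rewrite ?pz.
  by move=> _ /ltn_trans/[apply]; rewrite ltnn.
by move=> /ltn_trans/[apply]/ltn_trans/[apply]; rewrite ltnn.
Qed.

(** Only the triangles on either side of [k] change: the composites through [k]
    create the arrows of the two new triangles and cancel those sides of the old
    ones that do not contain [k].  Each pair of positions is a computation. *)
Lemma mutate_rotation (Q : quiver V) :
  (forall x y, Q x y = tree_arrow pos x y) ->
  forall x y, mutate_arrows k Q x y = tree_arrow (rotate_slot \o pos) x y.
Proof.
move=> QE x y.
have Qxx z : tree_arrow pos z z = false := tree_arrowxx z tree_pos.
have Q2 z t : tree_arrow pos z t - tree_arrow pos t z = tree_arrow pos z t.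
  by have := quiver_no_2cycle Q z t; rewrite !QE; do 2!case: tree_arrow => //; case.
rewrite /mutate_arrows /cancel_2cycles /reverse_at /add_composites !QE.
have [->|nxy] := eqVneq x y.
  by rewrite subnn (tree_arrowxx y rotate_is_tree).
have [xk|nxk] := eqVneq x k; have [yk|nyk] := eqVneq y k => /=.
- by case/eqP: nxy; rewrite xk.
- by rewrite xk !Qxx !muln0 !mul0n !addn0 Q2 (rotation_reverses nyk).2.
- by rewrite yk !Qxx !muln0 !mul0n !addn0 Q2 (rotation_reverses nxk).1.
have neq_slot : ((pos x).1 == (pos y).1) && ((pos x).2 == (pos y).2) = false.
  apply/andP => -[/eqP e1 /eqP e2]; case/eqP: nxy; apply: tree_pos.1.
  exact: injective_projections.
have one_parent : (p == Some x) && (p == Some y) = false.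
  by apply/andP => -[/eqP-> /eqP[e]]; rewrite e eqxx in nxy.
have nkx : (Some k == Some x) = false by rewrite (inj_eq Some_inj) eq_sym (negPf nxk).
have nky : (Some k == Some y) = false by rewrite (inj_eq Some_inj) eq_sym (negPf nyk).
have nkp := parent_neq; have npk : (p == Some k) = false by rewrite eq_sym.
have simps := (npk, nkp, eqxx, nkx, nky).
(* These facts stay in the goal, so that the case analysis evaluates them too. *)
move: (Q2 x y) neq_slot one_parent.
move: (@parent_not_below x y) (@parent_not_below y x).
rewrite /tree_arrow /= /rotate_slot /= -/p -/s.
case: (rotation_kindP nxk) => [q u px np nk|px|u px|q u px np nk];
  case: (rotation_kindP nyk) => [q' u' py np' nk'|py|u' py|q' u' py np' nk'];
  rewrite /= ?px ?py; case: (s) => //; try case: u; try case: u';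
  rewrite /= ?np ?nk ?np' ?nk' ?simps //=
    ?[_ == q]eq_sym ?[_ == q']eq_sym
    ?np ?nk ?np' ?nk' ?simps ?px ?py ?andbF ?andbT ?orbF //=;
  rewrite ?muln0 ?mul0n ?addn0 ?orbT // => px_y py_x *;
  by rewrite ?(px_y isT isT) ?(py_x isT isT).
Qed.

End Rotation.
End TreeQuivers.

(** Reversing the arrows at [k] reverses the composites through [k], so the second
    mutation compensates what the first one did to the other arrows; as there are
    no 2-cycles, the truncated subtractions lose nothing. *)
Lemma mutateK (V : finType) (Q : quiver V) (k : V) :
  mutate_arrows k (mutation Q k) =2 Q.
Proof.
move=> x y; rewrite /= /mutate_arrows /cancel_2cycles /reverse_at /add_composites.
have Qkk := quiver_no_loop Q k.
have [->|nxk] := eqVneq x k; have [->|nyk] := eqVneq y k;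
  rewrite /= ?eqxx ?(negPf nxk) ?(negPf nyk) /= ?orbT ?Qkk ?muln0 ?mul0n ?addn0 ?subn0 //.
- by case: (quiver_no_2cycle Q k y) => ->; rewrite ?(negPf nyk) /= ?subn0 ?sub0n ?subn0 ?addn0.
- by case: (quiver_no_2cycle Q k x) => ->; rewrite ?subn0 ?sub0n ?subn0 ?addn0.
case: (quiver_no_2cycle Q x y) => ->; case: (quiver_no_2cycle Q x k) => ->;
  case: (quiver_no_2cycle Q y k) => ->;
  rewrite ?mul0n ?muln0 ?subn0 ?sub0n ?addn0 ?add0n ?muln0 ?mul0n //;
  rewrite ?[Q k x * _]mulnC ?[Q k y * _]mulnC; lia.
Qed.

(** * Type A orientations *)

(** Hang the path from its first vertex, each vertex being the only child of the
    previous one.  The side of a child is free, so it can encode the orientation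
    of the edge above it. *)
Lemma type_A_tree_quiver (V : finType) (Q : quiver V) : type_A_orientation Q -> tree_quiver Q.
Proof.
case=> n [n_gt0 [f [g fK gK] Qf]].
pose parent x := if nat_of_ord (g x) is i.+1 then omap f (insub i) else None.
pose pos x : slot V := (parent x, if parent x is Some y then 0 < Q y x else true).
pose dep o := if o is Some x then (g x).+1 else 0.
have parentE x y : (parent x == Some y) = ((g y).+1 == g x :> nat).
  rewrite /parent; case gx: (nat_of_ord (g x)) => [|i] /=; first by [].
  have li : i < n by rewrite ltnW // -gx ltn_ord.
  rewrite insubT /= eqSS; apply/eqP/eqP => [[<-]|e]; first by rewrite fK.
  by congr Some; rewrite -(gK y); congr f; apply: val_inj.
have parentS x y : parent x = Some y -> g x = (g y).+1 :> nat.
  by move/eqP; rewrite parentE => /eqP.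
have parent_inj : injective parent.
  move=> x y; case ex: (parent x) => [z|] ey; apply: (can_inj gK); apply: ord_inj.
    by rewrite (parentS x z) // (parentS y z) // -ey.
  have parent0 w : parent w = None -> nat_of_ord (g w) = 0.
    rewrite /parent; case gw: (nat_of_ord (g w)) => [|i] //=.
    have li : i < n by rewrite ltnW // -gw ltn_ord.
    by rewrite insubT.
  by rewrite !parent0.
exists pos, dep; split.
  split; first by move=> x y [/parent_inj].
  by move=> x /=; case e: (parent x) => [y|] //=; rewrite (parentS x y).
move=> x y; rewrite /tree_arrow /=.
have -> : [&& parent x == parent y, (pos x).2 & ~~ (pos y).2] = false.
  by apply/and3P => -[/eqP/parent_inj-> ->].
have := Qf (g x) (g y); rewrite !gK -!parentE orbF /pos /=.
have [ey|_] := eqVneq (parent y) (Some x); have [ex|_] := eqVneq (parent x) (Some y).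
- by have := parentS _ _ ex; rewrite (parentS _ _ ey); lia.
- rewrite ey /=; lia.
- rewrite ex /=; lia.
by rewrite /=; lia.
Qed.

(** * Chains of siblings *)

(** At a vertex of maximal height both neighbours on the cycle are at most as
    high, so they coincide. *)
Lemma no_long_cycle (T : finType) (e : rel T) (h : T -> nat) (s : seq T) :
  (forall x c y, x != c -> y != c -> e x c -> e c y -> h x <= h c -> h y <= h c -> x = y) ->
  uniq s -> 2 < size s -> ~~ cycle e s.
Proof.
move=> meet us sz; apply/negP => cs.
have [c0 c0s] : {c0 | c0 \in s} by case: s sz {us cs} => // c0 s _; exists c0; rewrite mem_head.
have [c cs' cmax] := @arg_maxnP _ c0 [in s] h c0s.
have [n s' es] := rot_to cs'.
have mem z : (z \in s) = (z \in c :: s') by rewrite -es mem_rot.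
move: us sz cs; rewrite -(rot_uniq n) -(size_rot n) -(rot_cycle n) es.
case: s' es mem => [|y s'] // _ mem; case/lastP: s' mem => [|s' z] // mem.
rewrite /= !(inE, mem_rcons) !negb_or rcons_path last_rcons.
case/and3P=> /and3P[cy cz _] /andP[yz _] _ _ /and3P[ecy _ ezc].
have ms t : t \in [:: y; z] -> h t <= h c.
  by rewrite !inE => /orP[] /eqP-> ; apply: cmax; rewrite [_ \in _]mem !(inE, mem_rcons) eqxx ?orbT.
have := meet z c y; rewrite eq_sym cz eq_sym cy => /(_ isT isT ezc ecy).
by rewrite !ms ?inE ?eqxx ?orbT // => /(_ isT isT) ezy; rewrite ezy eqxx in yz.
Qed.

Section Chains.
Variables (V : finType) (pos : V -> slot V) (dep : option V -> nat) (Q : quiver V).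
Hypotheses (tree_pos : is_tree pos dep) (QE : forall x y, Q x y = tree_arrow pos x y).

Definition child (c : slot V) : option V := [pick x | pos x == c].

(** The right sibling comes first: vertical arrows point downwards in a chain, and
    siblings are joined by an arrow from left to right. *)
Definition sibling_chain (o : option V) : seq V :=
  pmap child [:: (o, false); (o, true)].

Lemma mem_sibling_chain o x : (x \in sibling_chain o) = ((pos x).1 == o).
Proof.
have childE (c : slot V) : (Some x == child c) = (pos x == c).
  rewrite /child; case: pickP => [y /eqP yc|none]; last by rewrite none.
  by rewrite -yc (inj_eq tree_pos.1).
rewrite mem_pmap /= !inE !childE; case: (pos x) => q [];
  by rewrite !xpair_eqE ?andbT ?andbF ?orbF.
Qed.

Variant chain_spec o : seq V -> Prop :=
| ChainNil : chain_spec o [::]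
| ChainOne x of (pos x).1 = o : chain_spec o [:: x]
| ChainTwo r l of pos r = (o, false) & pos l = (o, true) : chain_spec o [:: r; l].

Lemma sibling_chainP o : chain_spec o (sibling_chain o).
Proof.
rewrite /sibling_chain /= /child.
case: pickP => [r /eqP er|_]; case: pickP => [l /eqP el|_] /=.
- exact: ChainTwo.
- by apply: ChainOne; rewrite er.
- by apply: ChainOne; rewrite el.
exact: ChainNil.
Qed.

Lemma sibling_chain_uniq o : uniq (sibling_chain o).
Proof.
case: sibling_chainP => //= r l er el.
by rewrite inE andbT; apply/eqP => e; move: er; rewrite e el.
Qed.

Lemma sibling_chain_vertical o x0 l m :
  l < size (sibling_chain o) -> m < size (sibling_chain o) ->
  Q (nth x0 (sibling_chain o) l) (nth x0 (sibling_chain o) m) = (l == m.+1).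
Proof.
case: sibling_chainP => [|x ex|r t er et] //=; first by case: l m => [|l] [|m]; rewrite //= quiver_no_loop.
have nself (w : V) : (pos w).1 = o -> (o == Some w) = false.
  by move=> ew; apply/eqP => e; have := tree_pos.2 w; rewrite ew e ltnn.
case: l m => [|[|l]] [|[|m]] //= _ _; rewrite ?quiver_no_loop // QE /tree_arrow er et /=;
  by rewrite ?(nself r) ?(nself t) ?er ?et ?eqxx.
Qed.

Definition parents : {set option V} := [set o | sibling_chain o != [::]].

Definition chain_parent (i : 'I_#|parents|) : option V := enum_val i.

Lemma chain_parent_inj : injective chain_parent.
Proof. exact: enum_val_inj. Qed.

Definition chain_length (i : 'I_#|parents|) : nat := size (sibling_chain (chain_parent i)).

Definition chain_vertex (i : 'I_#|parents|) (l : 'I_(chain_length i)) : V :=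
  tnth (in_tuple (sibling_chain (chain_parent i))) l.

Lemma chain_length_gt0 i : 0 < chain_length i.
Proof. by have := enum_valP i; rewrite inE -size_eq0 -lt0n. Qed.

Lemma parent_chain_vertex i l : (pos (@chain_vertex i l)).1 = chain_parent i.
Proof. by apply/eqP; rewrite -mem_sibling_chain; exact: mem_tnth. Qed.

Lemma chain_vertex_inj i : injective (@chain_vertex i).
Proof. by apply/tuple_uniqP; exact: sibling_chain_uniq. Qed.

Lemma chain_vertical : vertical_arrows Q chain_vertex.
Proof.
move=> i l m; pose x0 := chain_vertex l.
rewrite /chain_vertex !(tnth_nth x0).
exact: (sibling_chain_vertical x0 (ltn_ord l) (ltn_ord m)).
Qed.

Lemma chain_of i x : (pos x).1 = chain_parent i -> exists l, @chain_vertex i l = x.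
Proof. by move/eqP; rewrite -mem_sibling_chain => /seq_tnthP[l ->]; exists l. Qed.

Lemma chain_exists x : exists i, (pos x).1 = chain_parent i.
Proof.
have xt : (pos x).1 \in parents.
  have : x \in sibling_chain (pos x).1 by rewrite mem_sibling_chain.
  by rewrite inE; case: sibling_chain.
by exists (enum_rank_in xt (pos x).1); rewrite /chain_parent enum_rankK_in.
Qed.

Lemma chain_vertex_bij :
  bijective (fun x : {i : 'I_#|parents| & 'I_(chain_length i)} => chain_vertex (tagged x)).
Proof.
pose vertex (s : {i : 'I_#|parents| & 'I_(chain_length i)}) : V := @chain_vertex (tag s) (tagged s).
have vertex_inj : injective vertex.
  move=> [i l] [j m] /= e; have eij : i = j.
    apply: chain_parent_inj; rewrite -(parent_chain_vertex l).
    by rewrite [chain_vertex l]e parent_chain_vertex.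
  by subst j; congr Tagged; apply: chain_vertex_inj.
have /fin_all_exists[g vertexK] x : exists s, vertex s = x.
  have [i ei] := chain_exists x; have [l el] := chain_of ei.
  by exists (Tagged (fun i => 'I_(chain_length i)) l).
by exists g => // s; apply: vertex_inj; rewrite vertexK.
Qed.

(** Siblings lie in the same chain, so an arrow between two chains joins a node to
    one of its children. *)
Lemma chain_arrow i j (l : 'I_(chain_length i)) (m : 'I_(chain_length j)) :
  i != j -> adjacent Q (chain_vertex l) (chain_vertex m) ->
  chain_parent j = Some (chain_vertex l) \/ chain_parent i = Some (chain_vertex m).
Proof.
move=> nij; have nparent : (chain_parent i == chain_parent j) = false.
  by rewrite (inj_eq chain_parent_inj) (negPf nij).
rewrite /adjacent !QE /tree_arrow !parent_chain_vertex nparent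
  [chain_parent j == chain_parent i]eq_sym nparent.
by rewrite !lt0b !orbF -!orbA => /or4P[] /andP[/eqP-> _]; auto.
Qed.

(** If [x] is the parent of chain [j], the arrows between its chain and chain [j]
    are those of [r -> x -> l], where [r] and [l] are the right and left child.
    Hence the path starts in chain [j] if there is a right child, and in chain
    [i] if there is only a left one. *)
Lemma oblique_below i j (x : 'I_(chain_length i)) :
  chain_parent j = Some (chain_vertex x) ->
  oblique_path Q chain_vertex i j \/ oblique_path Q chain_vertex j i.
Proof.
move=> ej.
have nparent : (chain_parent i == chain_parent j) = false.
  apply/eqP => e; have := tree_pos.2 (chain_vertex x).
  by rewrite parent_chain_vertex -ej e ltnn.
have nback m : (chain_parent i == Some (@chain_vertex j m)) = false.
  apply/eqP => e; have := tree_pos.2 (chain_vertex x).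
  have := tree_pos.2 (chain_vertex m); rewrite !parent_chain_vertex e ej => /ltn_trans/[apply].
  by rewrite ltnn.
pose side m := (pos (@chain_vertex j m)).2.
have down l m : Q (@chain_vertex i l) (chain_vertex m) = (l == x) && side m.
  rewrite QE /tree_arrow !parent_chain_vertex nparent nback ej !orbF.
  by rewrite (inj_eq Some_inj) (inj_eq (@chain_vertex_inj i)) eq_sym.
have up l m : Q (chain_vertex m) (@chain_vertex i l) = (l == x) && ~~ side m.
  rewrite QE /tree_arrow !parent_chain_vertex [chain_parent j == chain_parent i]eq_sym nparent nback ej !orbF /=.
  by rewrite (inj_eq Some_inj) (inj_eq (@chain_vertex_inj i)) eq_sym.
have side_inj : injective side.
  move=> m m' e; apply: chain_vertex_inj; apply: tree_pos.1.
  by apply: injective_projections; rewrite // !parent_chain_vertex.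
have side_order m m' : ~~ side m -> side m' -> m < m'.
  move=> sm sm'; have := chain_vertical m' m.
  rewrite QE /tree_arrow !parent_chain_vertex eqxx -/(side m) -/(side m') sm sm' !orbT.
  by case: eqP => // ->.
case: (pickP (fun m => ~~ side m)) => [r sr|no_r]; case: (pickP side) => [l sl|no_l].
- right; exists [:: r; l], [:: x]; split=> //=; [by right | by rewrite andbT side_order|].
  move=> m t; rewrite up down !inE !xpair_eqE.
  rewrite -(inj_eq side_inj m r) -(inj_eq side_inj m l) sl (negPf sr).
  by case: (side m); rewrite /= ?andbT ?andbF.
- right; exists [:: r], [:: x]; split=> //=; [by left|].
  move=> m t; rewrite up down !inE !xpair_eqE.
  by rewrite -(inj_eq side_inj m r) (negPf sr) no_l andbT andbF.
- left; exists [:: x], [:: l]; split=> //=; [by left|].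
  move=> t m; rewrite up down !inE !xpair_eqE -(inj_eq side_inj m l) sl.
  by have := no_r m; case: (side m) => //= _; rewrite andbF.
by have := no_r (Ordinal (chain_length_gt0 j)); rewrite no_l.
Qed.

Lemma chain_link i j : i != j -> chains_linked Q chain_vertex i j ->
  (exists l, chain_parent j = Some (@chain_vertex i l)) \/
  (exists m, chain_parent i = Some (@chain_vertex j m)).
Proof.
move=> nij /existsP[l /existsP[m /(chain_arrow nij)[e|e]]]; first by left; exists l.
by right; exists m.
Qed.

Lemma chain_oblique : oblique_arrows Q chain_vertex.
Proof.
move=> i j nij /(chain_link nij)[[l e]|[m e]]; first exact: oblique_below e.
by have [] := oblique_below e; auto.
Qed.

Lemma chains_linked_sym : symmetric (chains_linked Q chain_vertex).
Proof.
by move=> i j; apply/existsP/existsP => -[l /existsP[m a]]; exists m; apply/existsP; exists l;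
  rewrite adjacent_sym.
Qed.

(** The upper neighbour of a chain contains its parent, hence is determined. *)
Lemma chain_link_unique x c : x != c -> chains_linked Q chain_vertex x c ->
  dep (chain_parent x) <= dep (chain_parent c) ->
  exists2 l, chain_parent c = Some (@chain_vertex x l) & chain_parent x = (pos (@chain_vertex x l)).1.
Proof.
move=> nxc /(chain_link nxc)[[l e] _|[m e]]; first by exists l; rewrite ?parent_chain_vertex.
by have := tree_pos.2 (chain_vertex m); rewrite parent_chain_vertex -e ltnNge => /negPf->.
Qed.

Lemma chain_acyclic : chains_acyclic Q chain_vertex.
Proof.
move=> i p /andP[sz _] up pp; apply/negP => li.
suff /negP[] : ~~ cycle (chains_linked Q chain_vertex) (i :: p).
  by rewrite /= rcons_path pp chains_linked_sym.
apply: (@no_long_cycle _ _ (dep \o chain_parent)) => // x c y nxc nyc exc.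
rewrite chains_linked_sym => ecy dx dy.
have [l el xl] := chain_link_unique nxc exc dx; have [m em ym] := chain_link_unique nyc ecy dy.
by apply: chain_parent_inj; rewrite xl ym; move: el; rewrite em => -[->].
Qed.

End Chains.

Lemma tree_quiver_QN (V : finType) (Q : quiver V) (x : V) :
  tree_quiver Q -> exists N, 1 <= N /\ is_QN_quiver N Q.
Proof.
move=> [pos [dep [tree_pos QE]]]; exists #|parents pos|; split.
  by have [i _] := chain_exists tree_pos x; apply: leq_ltn_trans (ltn_ord i).
exists (@chain_length V pos), (@chain_vertex V pos); split.
- exact: chain_length_gt0.
- exact: chain_vertex_bij tree_pos.
- exact: chain_vertical tree_pos QE.
- exact: chain_oblique tree_pos QE.
exact: chain_acyclic tree_pos QE.
Qed.

(** * Transport along mutation sequences *)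

Lemma tree_quiver_mutation (V : finType) (Q : quiver V) (k : V) :
  tree_quiver Q -> tree_quiver (mutation Q k).
Proof.
move=> [pos [dep [tree_pos QE]]].
exists (rotate_slot pos k \o pos), (rotate_depth pos dep k); split.
  exact: rotate_is_tree.
exact: mutate_rotation tree_pos _ QE.
Qed.

Lemma tree_quiver_ext (V : finType) (a b : V -> V -> nat) :
  a =2 b -> tree_quiver a -> tree_quiver b.
Proof.
by move=> ab [pos [dep [tp aE]]]; exists pos, dep; split=> // x y; rewrite -ab.
Qed.

Theorem proposition4p12 (V : finType) (Q : quiver V) :
  mu_A Q -> exists N : nat, 1 <= N /\ is_QN_quiver N Q.
Proof.
case=> Q0 typeA [ks eQ].
have [n [n_gt0 [f _ _]]] := typeA.
apply: (tree_quiver_QN (f (Ordinal n_gt0))).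
have : tree_quiver (foldl (@mutation V) Q ks).
  exact: tree_quiver_ext (fun y z => esym (eQ y z)) (type_A_tree_quiver typeA).
elim: ks Q {eQ} => [|k ks IH] Q //= /IH /(tree_quiver_mutation k).
exact: tree_quiver_ext (mutateK Q k).
Qed.
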